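(* Let $X\subseteq\mathbb{R}$, $\varphi=(y_1,y_2):X\to\mathbb{R}^2$, let $F:\varphi(X)\to\mathbb{E}$ be a flexible function and let $G=F\circ\varphi$. Let $M\subsetneq\mathbb{R}$ be a neutrix, $a$ an $M$-interior point of $X$ and $b=(b_1,b_2)=(y_1(a),y_2(a))$. Assume that (a) there exist neutrices $N_1,N_2$ such that $b$ is an $N$-interior point of $\varphi(X)$, where $N=(N_1,N_2)$, and for $i\in\{1,2\}$ $$N_i\text{-}\lim_{h\twoheadrightarrow M}y_i(a+h)=b_i+N_i;$$ (b) there exist $p\in\{1,2\}$ and an $M$-neighborhood $U$ of $a+M$ such that $y_p(a+h)\notin b_p+N_p$ whenever $a+h\in U$ and $h\notin M$, and $F$ is strongly $N$-differentiable with respect to $y_p$ at $b$; (c) $\frac{dy_1}{d_Mx}(a)$, $\frac{dy_2}{d_Mx}(a)$, $\frac{\partial F}{\partial_{N_1}y_1}(b_1,b_2)$ and $\frac{\partial F}{\partial_{N_2}y_2}(b_1,b_2)$ are well-defined, $\frac{dy_1}{d_Mx}(a)$ or $\frac{\partial F}{\partial_{N_1}y_1}(b_1,b_2)$ is zeroless, and $\frac{dy_2}{d_Mx}(a)$ or $\frac{\partial F}{\partial_{N_2}y_2}(b_1,b_2)$ is zeroless. Then $$\frac{dG}{d_Mx}(a)\subseteq\frac{\partial F}{\partial_{N_1}y_1}(b_1,b_2)\,\frac{dy_1}{d_Mx}(a)+\frac{\partial F}{\partial_{N_2}y_2}(b_1,b_2)\,\frac{dy_2}{d_Mx}(a).$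$
   Context: Setting: Nelson's Internal Set Theory IST, together with external sets (in the sense of Kanovei and Reeken). External numbers. A (scalar) neutrix is a (possibly external) convex additive subgroup of $\mathbb{R}$; by convention all neutrices are different from $\mathbb{R}$. An external number is a set $\alpha=a+A=\{a+x: x\in A\}$ with $a\in\mathbb{R}$ and $A$ a neutrix; $\mathrm{N}(\alpha)=A$ is its neutrix part. $\mathbb{E}$ is the class of external numbers; real numbers ($A=\{0\}$) and neutrices are external numbers. $\alpha$ is zeroless if $0\notin\alpha$. For $\alpha=a+A,\beta=b+B$: $\alpha\pm\beta=a\pm b+\max\{A,B\}$ (max for inclusion), $\alpha\beta=ab+\max\{aB,bA,AB\}$; for a non-zero real $h$, $\alpha/h=a/h+A/h$. $|\alpha|=|a|+A$. $\alpha<\beta$ (equivalently $\beta>\alpha$) iff $s<t$ for all $s\in\alpha,t\in\beta$; in particular, for real $r$ and a neutrix $M$, $r>M$ means that $r$ exceeds all elements of $M$. Flexible functions. A flexible function on a non-empty $Y\subseteq\mathbb{R}^n$ ($n$ standard) is a map $F:Y\to\mathbb{E}$ whose graph is definable in IST; it is assumed to have a (not necessarily internal) representative $f:Y\to\mathbb{R}$, so $F(x)=f(x)+\mathrm{N}(F(x))$. Real-valued functions are special cases. Neighborhoods. An $M$-neighborhood of $a+M$ is an internal set $U\subseteq\mathbb{R}$ containing $(a-r,a+r)$ for some real $r>M$. For $N=(N_1,N_2)$, an $N$-neighborhood of $b$ (or of $(b_1+N_1,b_2+N_2)$) is an internal set $U\subseteq\mathbb{R}^2$ containing $(b_1-r_1,b_1+r_1)\times(b_2-r_2,b_2+r_2)$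 for some reals $r_i>N_i$. A point is an $M$-interior (resp. $N$-interior) point of a set if the set contains an $M$-neighborhood (resp. $N$-neighborhood) of it. Limits. Let $H$ be a flexible function, $K$ a neutrix. - Outer: $K\text{-}\lim_{x\to a+M}H(x)=\alpha$ if for every real $\varepsilon>K$ there is $\delta>M$ such that $|H(x)-\alpha|<\varepsilon$ for all $x$ in the domain of $H$ with $M<|x-a|<\delta$. - Inner: $K\text{-}\lim_{x\twoheadrightarrow a+M}H(x)=\alpha$ is defined in the same way with the condition $0<|x-a|<\delta$; ''$h\twoheadrightarrow M$'' is the case $a=0$. - Mixed (at $(0,0)$): $K\text{-}\lim_{h_1\to N_1,\,h_2\twoheadrightarrow N_2}H(h_1,h_2)=\alpha$ if for every real $\varepsilon>K$ there are $\delta_1>N_1,\delta_2>N_2$ such that $|H(h_1,h_2)-\alpha|<\varepsilon$ for all $(h_1,h_2)$ in the domain with $N_1<|h_1|<\delta_1$, $|h_2|<\delta_2$; analogously with the roles of the variables exchanged for $h_1\twoheadrightarrow N_1,\,h_2\to N_2$ (conditions $|h_1|<\delta_1$, $N_2<|h_2|<\delta_2$). In each case the limit without prefix $K$ is the intersection of all $\alpha\in\mathbb{E}$ such that $\alpha$ is the corresponding $\mathrm{N}(\alpha)$-limit; it is well-defined if there is at least one such $\alpha$, and it is then an external number. Derivatives (outer limits). $\frac{dH}{d_Mx}(a)=\lim_{x\to a+M}\frac{H(x)-H(a)}{x-a}$; $\frac{\partial F}{\partial_{N_1}y_1}(b)=\lim_{u\to b_1+N_1}\frac{F(u,b_2)-F(b_1,b_2)}{u-b_1}$;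 $\frac{\partial F}{\partial_{N_2}y_2}(b)=\lim_{v\to b_2+N_2}\frac{F(b_1,v)-F(b_1,b_2)}{v-b_2}$. Strong differentiability. Suppose the $N_i$-partial derivatives of $F$ at $b$ exist and there are flexible functions $\alpha_1,\alpha_2$ and an $N$-neighborhood $W$ of $b$ such that for all $h=(h_1,h_2)\neq(0,0)$ with $b+h\in W$ $$F(b_1+h_1,b_2+h_2)-F(b_1,b_2)-\frac{\partial F}{\partial_{N_1}y_1}(b)h_1-\frac{\partial F}{\partial_{N_2}y_2}(b)h_2=\alpha_1(h_1,h_2)h_1+\alpha_2(h_1,h_2)h_2.$$ $F$ is strongly $N$-differentiable with respect to $y_1$ at $b$ if such $\alpha_1,\alpha_2$ exist with $\lim_{h_1\to N_1,h_2\twoheadrightarrow N_2}\alpha_i(h_1,h_2)=\mathrm{N}\left(\frac{\partial F}{\partial_{N_i}y_i}(b)\right)$ for $i=1,2$; and with respect to $y_2$ if such $\alpha_1,\alpha_2$ exist with $\lim_{h_1\twoheadrightarrow N_1,h_2\to N_2}\alpha_i(h_1,h_2)=\mathrm{N}\left(\frac{\partial F}{\partial_{N_i}y_i}(b)\right)$ for $i=1,2$. *)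

(* Defs.v *)
From mathcomp Require Import all_boot all_order all_algebra.
From mathcomp Require Import boolp classical_sets.
Set Implicit Arguments.
Unset Strict Implicit.
Unset Printing Implicit Defensive.
Import Order.TTheory GRing.Theory Num.Theory.
Local Open Scope classical_set_scope.
Local Open Scope ring_scope.

(** * Internal Set Theory

   The theorems of IST are the statements true in all models of IST, so the
   setting is an arbitrary model.  External sets are the collections that are
   definable, with parameters, in the language with both membership and [st];
   internal sets are those collected by an element of the model. *)

(* First-order formulas in the language of IST, with de Bruijn variables. *)
Inductive formula : Type :=
| FMem of nat & nat
| FEq of nat & nat
| FSt of nat
| FFalse
| FImp of formula & formula
| FAll of formula.

Definition scons (V : Type) (x : V) (e : nat -> V) : nat -> V :=
  fun n => if n is m.+1 then e m else x.

Fixpoint sat (V : Type) (el : V -> V -> Prop) (st : V -> Prop)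
    (e : nat -> V) (f : formula) : Prop :=
  match f with
  | FMem i j => el (e i) (e j)
  | FEq i j => e i = e j
  | FSt i => st (e i)
  | FFalse => False
  | FImp g h => sat el st e g -> sat el st e h
  | FAll g => forall x : V, sat el st (scons x e) g
  end.

(* Internal formulas: those not mentioning [st]. *)
Fixpoint internal (f : formula) : bool :=
  match f with
  | FSt _ => false
  | FImp g h => internal g && internal h
  | FAll g => internal g
  | _ => true
  end.

Fixpoint occurs_free (n : nat) (f : formula) : bool :=
  match f with
  | FMem i j | FEq i j => (i == n) || (j == n)
  | FSt i => i == n
  | FFalse => false
  | FImp g h => occurs_free n g || occurs_free n h
  | FAll g => occurs_free n.+1 g
  end.

Definition subset_of (V : Type) (el : V -> V -> Prop) (x y : V) : Prop :=
  forall z, el z x -> el z y.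

(* Finiteness in the sense of Tarski, equivalent to the usual one in ZF. *)
Definition finite_in (V : Type) (el : V -> V -> Prop) (F : V) : Prop :=
  forall P : V, (exists s, el s P) -> (forall s, el s P -> subset_of el s F) ->
  exists2 s, el s P & forall t, el t P -> subset_of el t s -> t = s.

Record ZFC (V : Type) (el : V -> V -> Prop) (st : V -> Prop) : Prop := {
  zfc_extensionality : forall x y, (forall z, el z x <-> el z y) -> x = y;
  zfc_pairing : forall x y, exists p, forall z, el z p <-> z = x \/ z = y;
  zfc_union : forall x, exists u, forall z,
    el z u <-> exists2 y, el y x & el z y;
  zfc_powerset : forall x, exists p, forall z, el z p <-> subset_of el z x;
  zfc_infinity : exists w,
    (exists2 z, el z w & forall t, ~ el t z) /\
    (forall x, el x w ->
       exists2 s, el s w & forall t, el t s <-> el t x \/ t = x);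
  zfc_foundation : forall x, (exists y, el y x) ->
    exists2 y, el y x & forall z, el z y -> ~ el z x;
  zfc_separation : forall f e, internal f -> forall x,
    exists y, forall z, el z y <-> el z x /\ sat el st (scons z e) f;
  zfc_replacement : forall f e, internal f -> forall x,
    (forall u v w, el u x -> sat el st (scons u (scons v e)) f ->
       sat el st (scons u (scons w e)) f -> v = w) ->
    exists y, forall v,
      el v y <-> exists2 u, el u x & sat el st (scons u (scons v e)) f;
  zfc_choice : forall x, (forall y, el y x -> exists z, el z y) ->
    (forall y y' z, el y x -> el y' x -> el z y -> el z y' -> y = y') ->
    exists c, forall y, el y x ->
      exists z, forall t, el t y /\ el t c <-> t = z
}.

Record IST (V : Type) (el : V -> V -> Prop) (st : V -> Prop) : Prop := {
  ist_zfc : ZFC el st;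
  ist_idealization : forall f e, internal f ->
    (forall F, st F -> finite_in el F -> exists y, forall x, el x F ->
       sat el st (scons x (scons y e)) f) <->
    (exists y, forall x, st x -> sat el st (scons x (scons y e)) f);
  ist_standardization : forall f e x, st x ->
    exists2 y, st y & forall z, st z ->
      (el z y <-> el z x /\ sat el st (scons z e) f);
  ist_transfer : forall f e, internal f ->
    (forall n, occurs_free n.+1 f -> st (e n)) ->
    (forall x, st x -> sat el st (scons x e) f) ->
    forall x, sat el st (scons x e) f
}.

Structure istModel := IstModel {
  ist_carrier :> Type;
  el : ist_carrier -> ist_carrier -> Prop;
  st : ist_carrier -> Prop;
  ist_axioms : IST el st
}.

(* [p] is the Kuratowski pair {{x}, {x, y}}. *)
Definition opair (U : istModel) (p x y : U) : Prop :=
  forall z, el z p <->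
    (forall w, el w z <-> w = x) \/ (forall w, el w z <-> w = x \/ w = y).

Definition rel2 (U : istModel) (s x y : U) : Prop :=
  exists2 p, opair p x y & el p s.

Definition rel3 (U : istModel) (s x y z : U) : Prop :=
  exists p q, [/\ opair p x y, opair q p z & el q s].

(* The real numbers of a model: the elements of a standard set which, together
   with standard operations, is a complete ordered field in the sense of the
   model.  Completeness only concerns internal sets, so that [istR] is in
   general not Archimedean from the outside. *)
Structure istReals (U : istModel) := IstReals {
  istR :> realFieldType;
  code : istR -> U;
  code_inj : injective code;
  code_carrier :
    exists2 C, st C & forall v, el v C <-> exists x, v = code x;
  code_add : exists2 s, st s & forall x y z,
    rel3 s (code x) (code y) (code z) <-> x + y = z;
  code_mul : exists2 s, st s & forall x y z,
    rel3 s (code x) (code y) (code z) <-> x * y = z;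
  code_le : exists2 s, st s & forall x y,
    rel2 s (code x) (code y) <-> x <= y;
  code_complete : forall s : U, (exists x, el (code x) s) ->
    (exists m, forall x, el (code x) s -> x <= m) ->
    exists l, (forall x, el (code x) s -> x <= l) /\
      (forall m, (forall x, el (code x) s -> x <= m) -> l <= m)
}.

Definition internal1 (U : istModel) (R : istReals U) (S : set R) : Prop :=
  exists s : U, forall x : R, S x <-> el (code x) s.

Definition internal2 (U : istModel) (R : istReals U) (S : set (R * R)) : Prop :=
  exists s : U, forall x y : R, S (x, y) <-> rel2 s (code x) (code y).

Definition definable1 (U : istModel) (R : istReals U) (S : R -> Prop) : Prop :=
  exists f (e : nat -> U), forall x : R,
    S x <-> sat (@el U) (@st U) (scons (code x) e) f.

Definition definable2 (U : istModel) (R : istReals U)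
    (S : R -> R -> Prop) : Prop :=
  exists f (e : nat -> U), forall x y : R,
    S x y <-> sat (@el U) (@st U) (scons (code x) (scons (code y) e)) f.

Definition definable3 (U : istModel) (R : istReals U)
    (S : R -> R -> R -> Prop) : Prop :=
  exists f (e : nat -> U), forall x y z : R,
    S x y z <->
    sat (@el U) (@st U)
      (scons (code x) (scons (code y) (scons (code z) e))) f.

(** * External numbers *)

Record neutrix (U : istModel) (R : istReals U) (A : set R) : Prop := {
  neutrix_definable : definable1 A;
  neutrix0 : A 0;
  neutrixB : forall x y, A x -> A y -> A (x - y);
  neutrix_convex : forall x y z, A x -> A y -> x <= z <= y -> A z;
  neutrix_proper : A <> setT
}.

(* The pair (a, A) stands for the set [eset (a, A)] = a + A.  Distinct pairs may
   denote the same external number: compare them through [eset]. *)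
Record ext (R : realFieldType) := Ext { rep : R; npart : set R }.

Definition eset (R : realFieldType) (al : ext R) : set R :=
  [set rep al + x | x in npart al].

Definition external_number (U : istModel) (R : istReals U) (al : ext R) : Prop :=
  neutrix (npart al).

Definition ext_of_real (R : realFieldType) (r : R) : ext R := Ext r [set 0].

Definition ext_of_neutrix (R : realFieldType) (A : set R) : ext R := Ext 0 A.

(* Neutrices form a chain for inclusion, so the union is the maximum. *)
Definition nmax (R : realFieldType) (A B : set R) : set R := A `|` B.

Definition nscale (R : realFieldType) (r : R) (A : set R) : set R :=
  [set r * x | x in A].

Definition nmul (R : realFieldType) (A B : set R) : set R :=
  [set x * y | x in A & y in B].

Definition eadd (R : realFieldType) (al be : ext R) : ext R :=
  Ext (rep al + rep be) (nmax (npart al) (npart be)).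

Definition esub (R : realFieldType) (al be : ext R) : ext R :=
  Ext (rep al - rep be) (nmax (npart al) (npart be)).

Definition emul (R : realFieldType) (al be : ext R) : ext R :=
  Ext (rep al * rep be)
    (nmax (nmax (nscale (rep al) (npart be)) (nscale (rep be) (npart al)))
          (nmul (npart al) (npart be))).

Definition ediv (R : realFieldType) (al : ext R) (h : R) : ext R :=
  Ext (rep al / h) (nscale h^-1 (npart al)).

Definition eabs (R : realFieldType) (al : ext R) : ext R :=
  Ext `|rep al| (npart al).

Definition elt (R : realFieldType) (al be : ext R) : Prop :=
  forall s t, eset al s -> eset be t -> s < t.

Definition zeroless (R : realFieldType) (al : ext R) : Prop := ~ eset al 0.

Definition above (R : realFieldType) (M : set R) (r : R) : Prop :=
  forall x, M x -> x < r.

(** * Flexible functions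

   A function with domain D is given by its restriction to D, values outside D
   are irrelevant.  The representative is the [rep] component of the values. *)

Definition flexible1 (U : istModel) (R : istReals U) (D : set R)
    (H : R -> ext R) : Prop :=
  [/\ D !=set0, forall x, D x -> external_number (H x) &
      definable2 (fun x y : R => D x /\ eset (H x) y)].

Definition flexible2 (U : istModel) (R : istReals U) (D : set (R * R))
    (H : R * R -> ext R) : Prop :=
  [/\ D !=set0, forall x, D x -> external_number (H x) &
      definable3 (fun x1 x2 y : R => D (x1, x2) /\ eset (H (x1, x2)) y)].

(** * Neighborhoods *)

(* W is an M-neighborhood of a + M. *)
Definition nbhd1 (U : istModel) (R : istReals U) (M : set R) (a : R)
    (W : set R) : Prop :=
  internal1 W /\
  exists2 r, above M r & forall x, a - r < x < a + r -> W x.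

Definition nbhd2 (U : istModel) (R : istReals U) (N1 N2 : set R) (b : R * R)
    (W : set (R * R)) : Prop :=
  internal2 W /\
  exists r1 r2, [/\ above N1 r1, above N2 r2 &
    forall x1 x2, b.1 - r1 < x1 < b.1 + r1 -> b.2 - r2 < x2 < b.2 + r2 ->
      W (x1, x2)].

Definition interior1 (U : istModel) (R : istReals U) (M : set R) (X : set R)
    (a : R) : Prop :=
  exists2 W, nbhd1 M a W & W `<=` X.

Definition interior2 (U : istModel) (R : istReals U) (N1 N2 : set R)
    (Y : set (R * R)) (b : R * R) : Prop :=
  exists2 W, nbhd2 N1 N2 b W & W `<=` Y.

(** * Limits *)

(* [B] is the collection of regions over which the limit is taken; the outer,
   inner and mixed limits correspond to the bases below. *)
Definition Klim (T : Type) (R : realFieldType) (B : set (set T)) (D : set T)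
    (H : T -> ext R) (K : set R) (al : ext R) : Prop :=
  forall eps, above K eps ->
    exists2 P, B P &
      forall x, D x -> P x -> elt (eabs (esub (H x) al)) (ext_of_real eps).

(* x --> a + M *)
Definition outer (R : realFieldType) (M : set R) (a : R) : set (set R) :=
  [set P | exists2 d, above M d &
     P = [set x | above M `|x - a| /\ `|x - a| < d]].

(* x ->> a + M *)
Definition inner (R : realFieldType) (M : set R) (a : R) : set (set R) :=
  [set P | exists2 d, above M d & P = [set x | 0 < `|x - a| < d]].

(* h1 --> N1, h2 ->> N2 *)
Definition mixed1 (R : realFieldType) (N1 N2 : set R) : set (set (R * R)) :=
  [set P | exists d1 d2, [/\ above N1 d1, above N2 d2 &
     P = [set h | [/\ above N1 `|h.1|, `|h.1| < d1 & `|h.2| < d2]]]].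

(* h1 ->> N1, h2 --> N2 *)
Definition mixed2 (R : realFieldType) (N1 N2 : set R) : set (set (R * R)) :=
  [set P | exists d1 d2, [/\ above N1 d1, above N2 d2 &
     P = [set h | [/\ above N2 `|h.2|, `|h.1| < d1 & `|h.2| < d2]]]].

Definition limits (T : Type) (U : istModel) (R : istReals U)
    (B : set (set T)) (D : set T) (H : T -> ext R) : set (ext R) :=
  [set al | external_number al /\ Klim B D H (npart al) al].

Definition lim (T : Type) (U : istModel) (R : istReals U)
    (B : set (set T)) (D : set T) (H : T -> ext R) : set R :=
  \bigcap_(al in limits B D H) eset al.

Definition lim_well_defined (T : Type) (U : istModel) (R : istReals U)
    (B : set (set T)) (D : set T) (H : T -> ext R) : Prop :=
  limits B D H !=set0.

(* The limit is well-defined and is the external number al. *)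
Definition lim_is (T : Type) (U : istModel) (R : istReals U)
    (B : set (set T)) (D : set T) (H : T -> ext R) (al : ext R) : Prop :=
  [/\ lim_well_defined B D H, external_number al & eset al = lim B D H].

(** * Derivatives *)

Definition quotient (R : realFieldType) (H : R -> ext R) (a x : R) : ext R :=
  ediv (esub (H x) (H a)) (x - a).

Definition derivative (U : istModel) (R : istReals U) (M : set R) (X : set R)
    (H : R -> ext R) (a : R) : set R :=
  lim (outer M a) (X `\ a) (quotient H a).

Definition derivative_well_defined (U : istModel) (R : istReals U) (M : set R)
    (X : set R) (H : R -> ext R) (a : R) : Prop :=
  lim_well_defined (outer M a) (X `\ a) (quotient H a).

Definition derivative_is (U : istModel) (R : istReals U) (M : set R) (X : set R)
    (H : R -> ext R) (a : R) (al : ext R) : Prop :=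
  lim_is (outer M a) (X `\ a) (quotient H a) al.

Definition partial1_is (U : istModel) (R : istReals U) (N1 : set R)
    (Y : set (R * R)) (F : R * R -> ext R) (b : R * R) (al : ext R) : Prop :=
  derivative_is N1 [set u | Y (u, b.2)] (fun u => F (u, b.2)) b.1 al.

Definition partial2_is (U : istModel) (R : istReals U) (N2 : set R)
    (Y : set (R * R)) (F : R * R -> ext R) (b : R * R) (al : ext R) : Prop :=
  derivative_is N2 [set v | Y (b.1, v)] (fun v => F (b.1, v)) b.2 al.

(* Strong differentiability at b of a function F with domain Y, the limits of
   al1 and al2 being taken along B. *)
Definition strongly_differentiable (U : istModel) (R : istReals U)
    (B : set (set (R * R))) (N1 N2 : set R) (Y : set (R * R))
    (F : R * R -> ext R) (b : R * R) : Prop :=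
  exists dF1 dF2 : ext R,
    [/\ partial1_is N1 Y F b dF1, partial2_is N2 Y F b dF2 &
    exists (W : set (R * R)) (al1 al2 : R * R -> ext R),
      let D := [set h : R * R | h <> (0, 0) /\ W (b.1 + h.1, b.2 + h.2)] in
      [/\ nbhd2 N1 N2 b W /\ W `<=` Y,
          flexible2 D al1 /\ flexible2 D al2,
          forall h, D h ->
            eset (esub (esub (esub (F (b.1 + h.1, b.2 + h.2)) (F b))
                             (emul dF1 (ext_of_real h.1)))
                       (emul dF2 (ext_of_real h.2))) =
            eset (eadd (emul (al1 h) (ext_of_real h.1)) (emul (al2 h) (ext_of_real h.2))),
          lim_is B D al1 (ext_of_neutrix (npart dF1)) &
          lim_is B D al2 (ext_of_neutrix (npart dF2))]].

Definition strongly_differentiable1 (U : istModel) (R : istReals U)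
    (N1 N2 : set R) (Y : set (R * R)) (F : R * R -> ext R) (b : R * R) : Prop :=
  strongly_differentiable (mixed1 N1 N2) N1 N2 Y F b.

Definition strongly_differentiable2 (U : istModel) (R : istReals U)
    (N1 N2 : set R) (Y : set (R * R)) (F : R * R -> ext R) (b : R * R) : Prop :=
  strongly_differentiable (mixed2 N1 N2) N1 N2 Y F b.

(* y leaves b + N outside of a + M, in an M-neighborhood of a + M inside the
   domain X of y. *)
Definition leaves (U : istModel) (R : istReals U) (M : set R) (X : set R)
    (a : R) (y : R -> R) (N : set R) (b : R) : Prop :=
  exists W, [/\ nbhd1 M a W, W `<=` X &
    forall h, W (a + h) -> ~ M h -> ~ eset (Ext b N) (y (a + h))].

(* Main.v *)
Require Import Defs.
From mathcomp Require Import all_boot all_order all_algebra.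
From mathcomp Require Import boolp classical_sets.
From mathcomp Require Import ring lra.
Import Order.TTheory GRing.Theory Num.Theory.
Local Open Scope classical_set_scope.
Local Open Scope ring_scope.
Set Implicit Arguments.
Unset Strict Implicit.
Unset Printing Implicit Defensive.

(** The right-hand side dF1 * dy1 + dF2 * dy2 turns out to be itself one of the
   external numbers al such that al is the outer limit of the difference
   quotient of G up to the neutrix of al.  The derivative of G being the
   intersection of all of them, it is then well-defined and contained in this
   one.

   The argument is the classical one, with reals exceeding a neutrix as error
   bounds.  A derivative is defined as an intersection of limits, but it is a
   limit up to its own neutrix ([lim_is_Klim]), so that estimates by arbitrary
   reals above that neutrix are available.  Let h_i be the increments of y_i
   between a and x.  By strong differentiability ([strong_increment]),
     F (b + h) - F b = (d1 + u1) * h1 + (d2 + u2) * h2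
   where d_i represents the partial derivatives and u_i is as small as their
   neutrices permit.  This applies as soon as h enters the regions along which
   the errors of strong differentiability tend to their limits: the inner limits
   of y1 and y2 make h small, and since one of the y_p leaves b_p + N_p outside
   of a + M, the corresponding h_p is beyond N_p, as the mixed limit requires.
   After division by x - a, the fractions h_i / (x - a) are D_i + v_i, with D_i
   representing the derivative of y_i and v_i small, and it remains to see that
   (d_i + u_i) * (D_i + v_i) is close to d_i * D_i with respect to the neutrix of
   dF_i * dy_i.  This continuity of the product ([emul_continuous]) is where one
   factor has to be zeroless.

   Finally, al must be an external number, hence its neutrix must be definable.
   This asks for a formula defining the products of the elements of two definable
   sets, which is written with the graph of the multiplication as a parameter
   ([definable1_nmul]); scaling is the case where one of the sets is a singleton.
   In all estimates the neutrices only matter as convex subgroups. *)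

(** * Convex subgroups *)

Record cvx_subgroup (R : realFieldType) (A : set R) : Prop := {
  cvx_subgroup0 : A 0;
  cvx_subgroupB : forall x y, A x -> A y -> A (x - y);
  cvx_subgroup_convex : forall x y z, A x -> A y -> x <= z <= y -> A z
}.

Section CvxSubgroup.
Variable R : realFieldType.
Implicit Types (A B : set R) (r x y z e : R) (al be : ext R).

Lemma cvx_subgroupN A x : cvx_subgroup A -> A x -> A (- x).
Proof. by move=> [A0 AB _] Ax; rewrite -sub0r; apply: AB. Qed.

Lemma cvx_subgroupD A x y : cvx_subgroup A -> A x -> A y -> A (x + y).
Proof.
move=> Ag Ax Ay; rewrite -[y]opprK.
by apply: (cvx_subgroupB Ag) => //; apply: cvx_subgroupN.
Qed.

Lemma cvx_subgroup_norm A x : cvx_subgroup A -> A x -> A `|x|.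
Proof. by move=> Ag Ax; case: (ger0P x) => // _; apply: cvx_subgroupN. Qed.

Lemma cvx_subgroup_le A x y : cvx_subgroup A -> A x -> `|y| <= `|x| -> A y.
Proof.
move=> Ag /(cvx_subgroup_norm Ag) Ax; rewrite ler_norml => /andP[l u].
by apply: (cvx_subgroup_convex Ag (cvx_subgroupN Ag Ax) Ax); rewrite l u.
Qed.

Lemma cvx_subgroup_muln A x n : cvx_subgroup A -> A x -> A (x *+ n).
Proof.
move=> Ag Ax; elim: n => [|n IHn]; first exact: cvx_subgroup0.
by rewrite mulrS; apply: cvx_subgroupD.
Qed.

Lemma above_norm A x : cvx_subgroup A -> ~ A x -> above A `|x|.
Proof.
move=> Ag nAx z Az; rewrite ltNge; apply/negP => xz; apply: nAx.
by apply: (cvx_subgroup_le Ag Az); rewrite (le_trans xz) ?ler_norm.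
Qed.

Lemma above_gt0 A e : cvx_subgroup A -> above A e -> 0 < e.
Proof. by move=> Ag; apply; apply: cvx_subgroup0. Qed.

Lemma above_notin A e : above A e -> ~ A e.
Proof. by move=> Ae /Ae; rewrite ltxx. Qed.

Lemma above_gt_norm A x e : cvx_subgroup A -> above A e -> A x -> `|x| < e.
Proof. by move=> Ag Ae /(cvx_subgroup_norm Ag); apply: Ae. Qed.

(** Closure under integer multiples allows an error bound to be split into equal
   parts. *)
Lemma above_divn A e n : cvx_subgroup A -> above A e -> above A (e / n.+1%:R).
Proof.
move=> Ag Ae x Ax; rewrite ltr_pdivlMr ?ltr0Sn// mulr_natr.
by apply: Ae; apply: cvx_subgroup_muln.
Qed.

Lemma above_min A x y : above A x -> above A y -> above A (Num.min x y).
Proof. by move=> Ax Ay z Az; rewrite lt_min Ax ?Ay. Qed.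

Lemma cvx_subgroup_total A B :
  cvx_subgroup A -> cvx_subgroup B -> A `<=` B \/ B `<=` A.
Proof.
move=> Ag Bg; have [AB|nAB] := EM (A `<=` B); [by left | right=> z Bz].
move/existsNP: nAB => [x /not_implyP[Ax nBx]].
apply: (cvx_subgroup_le Ag Ax); apply: ltW.
exact: above_gt_norm Bg (above_norm Bg nBx) Bz.
Qed.

Lemma nmax_cvx_subgroup A B :
  cvx_subgroup A -> cvx_subgroup B -> cvx_subgroup (nmax A B).
Proof.
move=> Ag Bg; rewrite /nmax.
by have [/setUidPr ->|/setUidPl ->] := cvx_subgroup_total Ag Bg.
Qed.

Lemma nscale_cvx_subgroup r A : cvx_subgroup A -> cvx_subgroup (nscale r A).
Proof.
move=> Ag; split.
- by exists 0; [apply: cvx_subgroup0 | rewrite mulr0].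
- move=> _ _ [x Ax <-] [y Ay <-]; exists (x - y); last by rewrite mulrBr.
  exact: cvx_subgroupB.
move=> _ _ z [x Ax <-] [y Ay <-]; have [->|r0] := eqVneq r 0.
  rewrite !mul0r => z0; exists 0; first exact: cvx_subgroup0.
  by apply/eqP; rewrite mul0r eq_le.
have rz : r * (z / r) = z by rewrite mulrC divfK.
move=> xzy; exists (z / r) => //; move: xzy; rewrite -{1 2}rz.
case: (ltgtP r 0) r0 => // rl0 _.
  rewrite !ler_nM2l// => /andP[? ?].
  by apply: (cvx_subgroup_convex Ag Ay Ax); apply/andP.
by rewrite !ler_pM2l// => ?; apply: (cvx_subgroup_convex Ag Ax Ay).
Qed.

Lemma nmul_cvx_subgroup A B :
  cvx_subgroup A -> cvx_subgroup B -> cvx_subgroup (nmul A B).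
Proof.
move=> Ag Bg.
(* Everything bounded in size by a product is again a product. *)
have le_nmul x y z : A x -> B y -> `|z| <= `|x * y| -> nmul A B z.
  move=> Ax By; rewrite normrM => zxy; have [y0|y0] := eqVneq y 0.
    exists 0; first exact: cvx_subgroup0.
    exists 0; first exact: cvx_subgroup0.
    move: zxy; rewrite y0 normr0 mulr0 normr_le0 => /eqP ->.
    by rewrite mulr0.
  exists (z / y); last by exists y => //; rewrite divfK.
  apply: (cvx_subgroup_le Ag Ax).
  by rewrite normf_div ler_pdivrMr ?normr_gt0.
have maxin C (x x' : R) : C x -> C x' ->
    exists m, [/\ C m, `|x| <= `|m| & `|x'| <= `|m|].
  by move=> Cx Cx'; have [h|/ltW h] := leP `|x| `|x'|; [exists x' | exists x].
split.
- by exists 0; [|exists 0; [|rewrite mulr0]] => //; apply: cvx_subgroup0.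
- move=> _ _ [x Ax [y By <-]] [x' Ax' [y' By' <-]].
  have [m [Am xm x'm]] := maxin A x x' Ax Ax'.
  have [k [Bk yk y'k]] := maxin B y y' By By'.
  apply: (@le_nmul (m *+ 2) k) => //; first exact: cvx_subgroup_muln.
  rewrite mulrnAl normrMn mulr2n; apply: (le_trans (ler_normB _ _)).
  rewrite !normrM.
  by rewrite lerD// ler_pM.
move=> _ _ z [x Ax [y By <-]] [x' Ax' [y' By' <-]] /andP[xz zx'].
have [z0|/ltW z0] := leP 0 z.
  apply: (@le_nmul x' y') => //; rewrite (ger0_norm z0).
  by rewrite (le_trans zx') ?ler_norm.
apply: (@le_nmul x y) => //; rewrite (ler0_norm z0).
by rewrite -normrN (le_trans _ (ler_norm _))// lerN2.
Qed.

Lemma cvx_subgroup_set0 : cvx_subgroup ([set 0] : set R).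
Proof.
split=> [//|x y /= -> ->|x y z /= -> -> z0]; first by rewrite subr0.
by apply/eqP; rewrite eq_le andbC.
Qed.

Lemma zeroless_above al :
  cvx_subgroup (npart al) -> zeroless al -> above (npart al) `|rep al|.
Proof.
move=> Ag nz; apply: above_norm => // /(cvx_subgroupN Ag) h; apply: nz.
by exists (- rep al) => //; rewrite subrr.
Qed.

Lemma eset_rep al : cvx_subgroup (npart al) -> eset al (rep al).
Proof. by move=> [A0 _ _]; exists 0 => //; rewrite addr0. Qed.

Lemma eset_sub_rep al x : eset al x -> npart al (x - rep al).
Proof. by move=> [y Ay <-]; rewrite addrC addKr. Qed.

Lemma npart_subset al be : cvx_subgroup (npart al) -> cvx_subgroup (npart be) ->
  eset al `<=` eset be -> npart al `<=` npart be.
Proof.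
move=> Ag Bg ab x Ax.
have /eset_sub_rep h1 : eset be (rep al + x) by apply: ab; exists x.
have /eset_sub_rep h2 := ab _ (eset_rep Ag).
have -> : x = (rep al + x - rep be) - (rep al - rep be) by lra.
exact: (cvx_subgroupB Bg).
Qed.

Lemma elt_abs_sub al be e : elt (eabs (esub al be)) (ext_of_real e) <->
  forall t, npart al t \/ npart be t -> `|rep al - rep be| + t < e.
Proof.
split=> [h t At|h _ _ [t At <-] [_ -> <-]]; last by rewrite /= addr0; apply: h.
by apply: h; [exists t | exists 0 => //; rewrite addr0].
Qed.

End CvxSubgroup.


Lemma neutrix_cvx (U : istModel) (R : istReals U) (A : set R) :
  neutrix A -> cvx_subgroup A.
Proof. by case. Qed.

(** * Limits up to their own neutrix *)

(** A limit with neutrix K is the intersection of limits with neutrices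
   containing K.  A real exceeding K fails to lie in one of the latter neutrices,
   so that it exceeds it, and that coarser limit provides the estimate: its
   representative may be replaced by the one of the intersection. *)
Lemma lim_is_Klim (T : Type) (U : istModel) (R : istReals U) (B : set (set T))
    (D : set T) (H : T -> ext R) (al : ext R) :
  (forall x, D x -> cvx_subgroup (npart (H x))) ->
  lim_is (R := R) B D H al -> Klim B D H (npart al) al.
Proof.
move=> Hg [_ /neutrix_cvx Ag alE] e Ae; have e0 := above_gt0 Ag Ae.
have al_sub be : limits (R := R) B D H be -> eset al `<=` eset be.
  by move=> lbe x; rewrite alE; apply.
have [be [lbe nbe]] : exists be, limits (R := R) B D H be /\ ~ npart be e.
  apply: contrapT => /forallNP nex; apply: (above_notin Ae).
  suff /eset_sub_rep : eset al (rep al + e) by rewrite addrC addKr.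
  rewrite alE => be lbe.
  have [k Bk <-] := al_sub _ lbe _ (eset_rep Ag).
  have /neutrix_cvx Bg := lbe.1.
  exists (k + e); last by rewrite addrA.
  apply: (cvx_subgroupD Bg Bk); apply: contrapT => nBe.
  exact: (nex be).
have /neutrix_cvx Bg := lbe.1.
have Be : above (npart be) e by rewrite -(gtr0_norm e0); apply: above_norm.
have [P BP HP] := lbe.2 _ Be; exists P => // x Dx Px; apply/elt_abs_sub => t.
have /elt_abs_sub/[swap] Ht := HP x Dx Px.
have Hxg := Hg x Dx.
have Bc : npart be `|rep be - rep al|.
  apply: (cvx_subgroup_norm Bg); rewrite -opprB; apply: (cvx_subgroupN Bg).
  exact/eset_sub_rep/(al_sub _ lbe)/eset_rep.
move=> hb.
suff : `|rep be - rep al| + t < e - `|rep (H x) - rep be|.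
  by have := ler_distD (rep be) (rep (H x)) (rep al); lra.
case: Ht => [Ht|Kt].
  have [tc|/ltW ct] := leP t `|rep be - rep al|.
    have := hb _ (or_intror (cvx_subgroupD Bg Bc Bc)); lra.
  have := hb _ (or_introl (cvx_subgroupD Hxg Ht Ht)); lra.
have Bt : npart be t by apply: npart_subset (al_sub _ lbe) _ Kt.
have := hb _ (or_intror (cvx_subgroupD Bg Bc Bt)); lra.
Qed.

(** * Continuity of the product *)

Section Product.
Variable R : realFieldType.
Implicit Types (A B : set R) (d D e x : R).

Lemma above_div_scale A D e : cvx_subgroup A -> D != 0 ->
  above (nscale D A) e -> above A (e / `|D|).
Proof.
move=> Ag D0 De x Ax; rewrite ltr_pdivlMr ?normr_gt0//.
case: (ger0P D) => _; apply: De; first by exists x => //; rewrite mulrC.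
by exists (- x); [apply: cvx_subgroupN | rewrite mulrN -mulNr mulrC].
Qed.

(** As D lies beyond B, the perturbation v may be kept below D in size, and then
   the term u * v is absorbed by u * D.  What remains is d * v and u * D, which
   are controlled because e exceeds the neutrices d * B and D * A. *)
Lemma mul_continuous_zeroless A B d D e :
  cvx_subgroup A -> cvx_subgroup B -> above B `|D| ->
  above (nscale d B) e -> above (nscale D A) e ->
  exists e1 e2, [/\ above A e1, above B e2 &
    forall u v, `|u| < e1 -> `|v| < e2 -> `|(d + u) * (D + v) - d * D| < e].
Proof.
move=> Ag Bg BD dB DA; have D0 := above_gt0 Bg BD.
have e0 := above_gt0 (nscale_cvx_subgroup d Bg) dB.
have Dn0 : D != 0 by rewrite -normr_gt0.
have [e2 [Be2 e2D e2d]] : exists e2,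
    [/\ above B e2, e2 <= `|D| & forall v, `|v| < e2 -> `|d * v| < e / 2].
  have [->|d0] := eqVneq d 0.
    by exists `|D|; split=> // v _; rewrite mul0r normr0 divr_gt0.
  exists (Num.min `|D| (e / `|d| / 2)); split.
  - apply: above_min => //; apply: (@above_divn _ _ _ 1) => //.
    exact: above_div_scale.
  - by rewrite ge_min lexx.
  move=> v; rewrite lt_min => /andP[_]; rewrite normrM mulrAC.
  by rewrite ltr_pdivlMr ?normr_gt0// mulrC.
exists (e / `|D| / 4), e2; split=> //.
  by apply: (@above_divn _ _ _ 3) => //; apply: above_div_scale.
move=> u v ue ve.
have -> : (d + u) * (D + v) - d * D = d * v + u * (D + v) by ring.
have h1 := e2d v ve.
have h2 : `|u * (D + v)| < e / 2.
  have hD : `|D + v| <= 2 * `|D| by have := ler_normD D v; lra.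
  rewrite normrM; apply: (le_lt_trans (ler_wpM2l (normr_ge0 _) hD)).
  move: ue; rewrite mulrAC ltr_pdivlMr// => ue.
  by rewrite mulrCA; lra.
have := ler_normD (d * v) (u * (D + v)); lra.
Qed.

(** Some zerolessness is necessary.  Let one factor be the neutrix of the
   infinitesimals and the other one that of the limited numbers: their product
   consists of infinitesimals, so that 1 exceeds it, but a real beyond the first
   neutrix is not infinitesimal, a real beyond the second one is unlimited, and
   the product of two such reals is unlimited. *)
Lemma emul_continuous (al be : ext R) e :
  cvx_subgroup (npart al) -> cvx_subgroup (npart be) ->
  zeroless be \/ zeroless al ->
  above (npart (emul al be)) e ->
  exists e1 e2, [/\ above (npart al) e1, above (npart be) e2 &
    forall u v, `|u| < e1 -> `|v| < e2 ->
      `|(rep al + u) * (rep be + v) - rep al * rep be| < e].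
Proof.
move=> Ag Bg zl Ae.
have h1 : above (nscale (rep al) (npart be)) e.
  by move=> x hx; apply: Ae; left; left.
have h2 : above (nscale (rep be) (npart al)) e.
  by move=> x hx; apply: Ae; left; right.
case: zl => [/(zeroless_above Bg)|/(zeroless_above Ag)] z.
  exact: mul_continuous_zeroless.
have [e2 [e1 [? ? H]]] := mul_continuous_zeroless Bg Ag z h2 h1.
exists e1, e2; split=> // u v ue ve.
by rewrite mulrC [rep al * _]mulrC; apply: H.
Qed.

End Product.

(** * Definability *)

Section Expressible.
Variables (V : Type) (el : V -> V -> Prop) (st : V -> Prop).
Implicit Types (P Q : (nat -> V) -> Prop) (f : formula) (e : nat -> V).

Definition expressible P := exists f, forall e, P e <-> sat el st e f.

(** Renaming of the free variables; [scons 0] keeps the bound one in place. *)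
Fixpoint rename (r : nat -> nat) f : formula :=
  match f with
  | FMem i j => FMem (r i) (r j)
  | FEq i j => FEq (r i) (r j)
  | FSt i => FSt (r i)
  | FFalse => FFalse
  | FImp g h => FImp (rename r g) (rename r h)
  | FAll g => FAll (rename (scons 0%N (fun n => (r n).+1)) g)
  end.

Lemma sat_rename r f e :
  sat el st e (rename r f) <-> sat el st (fun n => e (r n)) f.
Proof.
elim: f r e => //= [g IHg h IHh|g IHg] r e.
  by split=> gh /IHg/gh/IHh.
suff E x : scons x (fun n => e (r n)) =
    fun n => scons x e (scons 0%N (fun n => (r n).+1) n).
  by split=> H x; have := H x; rewrite ?E => /IHg; rewrite ?E.
by apply: funext => -[].
Qed.

Lemma expressible_sat r f :
  expressible (fun e => sat el st (fun n => e (r n)) f).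
Proof. by exists (rename r f) => e; apply: iff_sym; apply: sat_rename. Qed.

Lemma expressible_mem i j : expressible (fun e => el (e i) (e j)).
Proof. by exists (FMem i j). Qed.

Lemma expressible_eq i j : expressible (fun e => e i = e j).
Proof. by exists (FEq i j). Qed.

Lemma expressible_imp P Q :
  expressible P -> expressible Q -> expressible (fun e => P e -> Q e).
Proof.
by move=> [f Pf] [g Qg]; exists (FImp f g) => e /=; split=> PQ /Pf/PQ/Qg.
Qed.

Lemma expressible_not P : expressible P -> expressible (fun e => ~ P e).
Proof. by move=> Pe; apply: expressible_imp => //; exists FFalse. Qed.

Lemma expressible_ext P Q :
  (forall e, Q e <-> P e) -> expressible P -> expressible Q.
Proof. by move=> QP [f Pf]; exists f => e; apply: iff_trans (QP e) (Pf e). Qed.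

Lemma expressible_and P Q :
  expressible P -> expressible Q -> expressible (fun e => P e /\ Q e).
Proof.
move=> Pe Qe; apply: (@expressible_ext (fun e => ~ (P e -> ~ Q e))).
  by move=> e; split=> [[p q]|/not_implyP[p /contrapT q]//]; apply.
by do ![apply: expressible_not | apply: expressible_imp].
Qed.

Lemma expressible_or P Q :
  expressible P -> expressible Q -> expressible (fun e => P e \/ Q e).
Proof.
move=> Pe Qe; apply: (@expressible_ext (fun e => ~ P e -> Q e)).
  move=> e; split=> [[]//|].
  by have [p|np h] := EM (P e); [left|right; apply: h].
by apply: expressible_imp => //; apply: expressible_not.
Qed.

Lemma expressible_iff P Q :
  expressible P -> expressible Q -> expressible (fun e => P e <-> Q e).
Proof. by move=> Pe Qe; apply: expressible_and; apply: expressible_imp. Qed.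

(** In the premise the bound variable has become variable 0 and the others are
   shifted, so that formulas with nested quantifiers are built by unification. *)
Lemma expressible_all (Q : V -> (nat -> V) -> Prop) :
  expressible (fun e => Q (e 0%N) (fun n => e n.+1)) ->
  expressible (fun e => forall x, Q x e).
Proof.
move=> [f Qf]; exists (FAll f) => e /=.
by split=> H x; have := H x; [move/(Qf (scons x e)) | move/Qf].
Qed.

Lemma expressible_ex (Q : V -> (nat -> V) -> Prop) :
  expressible (fun e => Q (e 0%N) (fun n => e n.+1)) ->
  expressible (fun e => exists x, Q x e).
Proof.
move=> Qe; apply: (@expressible_ext (fun e => ~ forall x, ~ Q x e)).
  by move=> e; split=> [[x Qx] /(_ x)//|/existsNP[x /contrapT Qx]]; exists x.
by apply: expressible_not; apply: expressible_all; apply: expressible_not.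
Qed.

End Expressible.

Lemma expressible_opair (U : istModel) i j k :
  expressible (@el U) (@st U) (fun e => opair (e i) (e j) (e k)).
Proof.
rewrite /opair; do ![apply: expressible_all | apply: expressible_iff
  | apply: expressible_or | apply: expressible_mem | apply: expressible_eq].
Qed.

Lemma expressible_rel3 (U : istModel) i j k l :
  expressible (@el U) (@st U) (fun e => rel3 (e i) (e j) (e k) (e l)).
Proof.
apply: (@expressible_ext _ _ _ (fun e => exists p q,
    (opair p (e j) (e k) /\ opair q p (e l)) /\ el q (e i))).
  move=> e; split=> [[p [q []]]|[p [q [[]]]]] *; exists p, q; first by [].
  by split.
do 2![apply: expressible_ex].
apply: expressible_and; last exact: expressible_mem.
by apply: expressible_and; apply: expressible_opair.
Qed.

Section Definable.
Variables (U : istModel) (R : istReals U).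
Implicit Types (A B : set R).

(** Merges the parameters of two formulas, so that both can be read off a single
   environment after renaming. *)
Definition interleave (e1 e2 : nat -> U) (n : nat) : U :=
  if odd n then e2 n./2 else e1 n./2.

Lemma interleave_double e1 e2 n : interleave e1 e2 n.*2 = e1 n.
Proof. by rewrite /interleave odd_double doubleK. Qed.

Lemma interleave_doubleS e1 e2 n : interleave e1 e2 n.*2.+1 = e2 n.
Proof. by rewrite /interleave /= odd_double uphalf_double. Qed.

Lemma definable1_set1 (r : R) : definable1 (R := R) [set r].
Proof.
exists (FEq 0 1), (fun _ => code r) => x /=.
by split=> [->|/code_inj].
Qed.

Lemma definable1_nmul A B : definable1 (R := R) A -> definable1 (R := R) B ->
  definable1 (R := R) (nmul A B).
Proof.
move=> [f [e1 Af]] [g [e2 Bg]].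
have [C _ CP] := code_carrier R; have [s _ sP] := code_mul R.
(* The variables 0 to 4 are the second factor, the first factor, the product,
   the set of real numbers and the graph of the multiplication. *)
pose rA := scons 1%N (fun m => m.*2.+1.+4).
pose rB := scons 0%N (fun m => m.*2.+2.+4).
pose P (e : nat -> U) :=
  ((el (e 1%N) (e 3) /\ el (e 0%N) (e 3)) /\
   rel3 (e 4) (e 1%N) (e 0%N) (e 2)) /\
  (sat (@el U) (@st U) (fun n => e (rA n)) f /\
   sat (@el U) (@st U) (fun n => e (rB n)) g).
have Pe : expressible (@el U) (@st U) P.
  apply: expressible_and; apply: expressible_and; try exact: expressible_sat.
    by apply: expressible_and; apply: expressible_mem.
  exact: expressible_rel3.
have [h Hh] : expressible (@el U) (@st U) (fun e =>
    exists x y, P (scons y (scons x e))).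
  do 2![apply: expressible_ex].
  have -> : (fun e : nat -> U => P (scons (e 0%N) (scons (e 1%N)
      (fun n => e n.+2)))) = P.
    by apply: funext => e; congr P; apply: funext => -[|[|n]].
  exact: Pe.
pose e := scons C (scons s (interleave e1 e2)).
exists h, e => z; apply: iff_trans (Hh _).
have PE x y : P (scons (code y) (scons (code x) (scons (code z) e))) <->
    [/\ A x, B y & x * y = z].
  rewrite /P.
  have -> : (fun n => scons (code y) (scons (code x) (scons (code z) e))
      (rA n)) = scons (code x) e1.
    by apply: funext => -[//|n] /=; apply: interleave_double.
  have -> : (fun n => scons (code y) (scons (code x) (scons (code z) e))
      (rB n)) = scons (code y) e2.
    by apply: funext => -[//|n] /=; apply: interleave_doubleS.
  split=> [[[_ /sP xyz] [/Af Ax /Bg By]]//|[/Af Ax /Bg By /sP xyz]].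
  by do ![split] => //; apply/CP; [exists x | exists y].
split=> [[x Ax [y By xyz]]|[u [v Puv]]].
  by exists (code x), (code y); apply/PE.
have [[[/CP[x /= ux] /CP[y /= vy]] _] _] := Puv.
by move: Puv; rewrite ux vy => /PE[Ax By xyz]; exists x => //; exists y.
Qed.

(** * Operations on external numbers *)

Lemma nmax_neutrix A B : neutrix (R := R) A -> neutrix (R := R) B ->
  neutrix (R := R) (nmax A B).
Proof.
move=> An Bn; rewrite /nmax.
have [/setUidPr ->|/setUidPl ->] // :=
  cvx_subgroup_total (neutrix_cvx An) (neutrix_cvx Bn).
Qed.

Lemma neutrix_notin A : neutrix (R := R) A -> exists c, ~ A c.
Proof.
move=> An; apply/existsNP => AT; apply: (neutrix_proper An).
by apply/seteqP; split.
Qed.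

Lemma neutrix_of_cvx A : definable1 (R := R) A -> cvx_subgroup A ->
  (exists c, ~ A c) -> neutrix (R := R) A.
Proof.
by move=> Ad [A0 AB Ac] [c Ac']; split=> // AT; apply: Ac'; rewrite AT.
Qed.

Lemma nscale_neutrix r A : neutrix (R := R) A -> neutrix (R := R) (nscale r A).
Proof.
move=> An; apply: neutrix_of_cvx.
- have -> : nscale r A = nmul [set r] A.
    apply/seteqP; split=> [_ [x Ax <-]|_ [_ -> [x Ax <-]]]; last by exists x.
    by exists r => //; exists x.
  apply: definable1_nmul; [exact: definable1_set1 | exact: neutrix_definable].
- exact/nscale_cvx_subgroup/neutrix_cvx.
have [c nAc] := neutrix_notin An; have [->|r0] := eqVneq r 0.
  by exists 1 => -[x _ /esym/eqP]; rewrite mul0r oner_eq0.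
by exists (r * c) => -[x Ax /(mulfI r0) xc]; apply: nAc; rewrite -xc.
Qed.

Lemma nmul_neutrix A B : neutrix (R := R) A -> neutrix (R := R) B ->
  neutrix (R := R) (nmul A B).
Proof.
move=> An Bn; have Ag := neutrix_cvx An; have Bg := neutrix_cvx Bn.
apply: neutrix_of_cvx.
- by apply: definable1_nmul; apply: neutrix_definable.
- exact: nmul_cvx_subgroup.
have [c /(above_norm Ag) Ac] := neutrix_notin An.
have [d /(above_norm Bg) Bd] := neutrix_notin Bn.
exists (c * d) => -[x /(above_gt_norm Ag Ac) xc [y /(above_gt_norm Bg Bd) yd]].
move/(congr1 Num.norm); rewrite !normrM => E.
by have := ltr_pM (normr_ge0 x) (normr_ge0 y) xc yd; rewrite E ltxx.
Qed.

Lemma emul_external (al be : ext R) : external_number (R := R) al ->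
  external_number (R := R) be -> external_number (R := R) (emul al be).
Proof.
move=> An Bn; apply: nmax_neutrix; last exact: nmul_neutrix.
by apply: nmax_neutrix; apply: nscale_neutrix.
Qed.

Lemma eadd_external (al be : ext R) : external_number (R := R) al ->
  external_number (R := R) be -> external_number (R := R) (eadd al be).
Proof. exact: nmax_neutrix. Qed.

End Definable.

(** * The increments of a strongly differentiable function *)

Lemma npart_emul_real (R : realFieldType) (al : ext R) h m :
  cvx_subgroup (npart al) -> npart (emul al (ext_of_real h)) m ->
  exists2 n, npart al n & m = n * h.
Proof.
move=> Ag [[[_ -> <-]|[n An <-]]|[n An [_ -> <-]]].
- by exists 0; [apply: cvx_subgroup0 | rewrite mulr0 mul0r].
- by exists n => //; rewrite mulrC.
- by exists 0; [apply: cvx_subgroup0 | rewrite mulr0 mul0r].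
Qed.

Lemma quotient_cvx_subgroup (R : realFieldType) (H : R -> ext R) a x :
  cvx_subgroup (npart (H x)) -> cvx_subgroup (npart (H a)) ->
  cvx_subgroup (npart (quotient H a x)).
Proof.
by move=> Hx Ha; apply: nscale_cvx_subgroup; apply: nmax_cvx_subgroup.
Qed.

Lemma norm_lt_halfD (R : realFieldType) (k n x e : R) :
  `|k| < e / 2 -> `|x - 0| + `|n| < e / 2 -> `|k + x + n| < e.
Proof.
rewrite subr0 => ke xn; have := ler_normD (k + x) n; have := ler_normD k x.
lra.
Qed.

(** The defining identity of strong differentiability is an equality of external
   numbers, so it also governs the neutrices: every t in the neutrix of the
   increment of F comes from one of the two products on the right.  This
   neutrix, the errors alpha_i and the indeterminacy of the partial derivatives
   are all absorbed by small perturbations u1, u2 of the partial derivatives. *)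
Lemma strong_increment (U : istModel) (R : istReals U) (B : set (set (R * R)))
    (N1 N2 : set R) (Y : set (R * R)) (F : R * R -> ext R) (b : R * R)
    (dF1 dF2 : ext R) :
  partial1_is N1 Y F b dF1 -> partial2_is N2 Y F b dF2 ->
  strongly_differentiable B N1 N2 Y F b ->
  exists2 W, nbhd2 N1 N2 b W &
    forall e1 e2, above (npart dF1) e1 -> above (npart dF2) e2 ->
    exists P1 P2, [/\ B P1, B P2 & forall h, h <> (0, 0) ->
      W (b.1 + h.1, b.2 + h.2) -> P1 h -> P2 h ->
      forall t, nmax (npart (F (b.1 + h.1, b.2 + h.2))) (npart (F b)) t ->
      exists u1 u2, [/\ `|u1| < e1, `|u2| < e2 &
        rep (F (b.1 + h.1, b.2 + h.2)) - rep (F b) + t =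
        (rep dF1 + u1) * h.1 + (rep dF2 + u2) * h.2]].
Proof.
move=> [_ /neutrix_cvx Ag1 E1] [_ /neutrix_cvx Ag2 E2].
move=> [d1 [d2 [[_ /neutrix_cvx Dg1 E1'] [_ /neutrix_cvx Dg2 E2']]]].
move=> [W [al1 [al2 [[Wb _] [[_ x1 _] [_ x2 _]] eqF lim1 lim2]]]].
have {}E1 : eset d1 = eset dF1 by rewrite E1 E1'.
have {}E2 : eset d2 = eset dF2 by rewrite E2 E2'.
have K1 : npart d1 = npart dF1.
  by apply/seteqP; split; apply: npart_subset => //; rewrite E1.
have K2 : npart d2 = npart dF2.
  by apply/seteqP; split; apply: npart_subset => //; rewrite E2.
have k1 : npart dF1 (rep d1 - rep dF1).
  by apply: eset_sub_rep; rewrite -E1; apply: eset_rep.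
have k2 : npart dF2 (rep d2 - rep dF2).
  by apply: eset_sub_rep; rewrite -E2; apply: eset_rep.
have {}lim1 := lim_is_Klim (fun h Dh => neutrix_cvx (x1 h Dh)) lim1.
have {}lim2 := lim_is_Klim (fun h Dh => neutrix_cvx (x2 h Dh)) lim2.
exists W => // e1 e2 /(above_divn 1 Ag1) Ae1 /(above_divn 1 Ag2) Ae2.
have [P1 BP1 HP1] := lim1 (e1 / 2) ltac:(by rewrite /= K1).
have [P2 BP2 HP2] := lim2 (e2 / 2) ltac:(by rewrite /= K2).
exists P1, P2; split=> // h h0 Wh P1h P2h t Ft.
have Dh : h <> (0, 0) /\ W (b.1 + h.1, b.2 + h.2) by [].
have {}HP1 := (elt_abs_sub _ _ _).1 (HP1 h Dh P1h).
have {}HP2 := (elt_abs_sub _ _ _).1 (HP2 h Dh P2h).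
have /neutrix_cvx X1 := x1 h Dh; have /neutrix_cvx X2 := x2 h Dh.
have [m Hm mE] : eset (eadd (emul (al1 h) (ext_of_real h.1))
    (emul (al2 h) (ext_of_real h.2)))
    (rep (F (b.1 + h.1, b.2 + h.2)) - rep (F b) - rep d1 * h.1
     - rep d2 * h.2 + t).
  by rewrite -eqF//; exists t => //; left; left.
have [n1 [n2 [Hn1 Hn2 mn]]] : exists n1 n2,
    [/\ npart (al1 h) n1, npart (al2 h) n2 & m = n1 * h.1 + n2 * h.2].
  case: Hm => [/(npart_emul_real X1)[n Hn ->]|/(npart_emul_real X2)[n Hn ->]].
    by exists n, 0; split; rewrite ?mul0r ?addr0//; apply: cvx_subgroup0.
  by exists 0, n; split; rewrite ?mul0r ?add0r//; apply: cvx_subgroup0.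
exists (rep d1 - rep dF1 + rep (al1 h) + n1),
  (rep d2 - rep dF2 + rep (al2 h) + n2); split.
- apply: norm_lt_halfD; first exact: above_gt_norm Ae1 k1.
  by apply: HP1; left; apply: cvx_subgroup_norm.
- apply: norm_lt_halfD; first exact: above_gt_norm Ae2 k2.
  by apply: HP2; left; apply: cvx_subgroup_norm.
by move: mE; rewrite mn /=; lra.
Qed.

(** * The chain rule *)

(** The filter behind outer limits at a + M, which combines estimates. *)
Definition near_outside (R : realFieldType) (M : set R) (a : R) (X : set R)
    (Q : R -> Prop) : Prop :=
  exists2 d, above M d & forall x, (X `\ a) x -> above M `|x - a| ->
    `|x - a| < d -> Q x.

Section NearOutside.
Variables (R : realFieldType) (M X : set R) (a : R).
Implicit Types (Q : R -> Prop).

Lemma near_outside_and Q1 Q2 : near_outside M a X Q1 -> near_outside M a X Q2 ->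
  near_outside M a X (fun x => Q1 x /\ Q2 x).
Proof.
move=> [d1 Md1 H1] [d2 Md2 H2]; exists (Num.min d1 d2); first exact: above_min.
by move=> x Xx Mx; rewrite lt_min => /andP[? ?]; split; [apply: H1|apply: H2].
Qed.

Lemma near_outside_mono Q1 Q2 : (forall x, (X `\ a) x -> Q1 x -> Q2 x) ->
  near_outside M a X Q1 -> near_outside M a X Q2.
Proof.
by move=> Q12 [d Md H]; exists d => // x Xx *; apply: Q12 => //; apply: H.
Qed.

Lemma Klim_outerP (H : R -> ext R) (K : set R) (al : ext R) :
  Klim (outer M a) (X `\ a) H K al <->
  forall e, above K e -> near_outside M a X
    (fun x => elt (eabs (esub (H x) al)) (ext_of_real e)).
Proof.
split=> lim e /lim => [[_ [d Md ->] HP]|[d Md HP]].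
  by exists d => // x Xx Mx xd; apply: HP.
by exists [set x | above M `|x - a| /\ `|x - a| < d];
  [exists d | move=> x Xx [Mx xd]; apply: HP].
Qed.

Lemma Klim_inner_near (y : R -> R) (N : set R) e : cvx_subgroup N ->
  Klim (inner M 0) [set h | X (a + h)] (fun h => ext_of_real (y (a + h)))
    N (Ext (y a) N) -> above N e ->
  near_outside M a X (fun x => `|y x - y a| < e).
Proof.
move=> Ng lim Ne; have [_ [d Md ->] HP] := lim e Ne.
exists d => // x [Xx xa] Mx xd.
have xE : a + (x - a) = x by rewrite addrC subrK.
have /elt_abs_sub : elt (eabs (esub (ext_of_real (y (a + (x - a))))
    (Ext (y a) N))) (ext_of_real e).
  apply: HP; rewrite /= ?xE// subr0 xd andbT normr_gt0 subr_eq0.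
  exact/eqP.
by rewrite xE => /(_ 0); rewrite addr0; apply; left.
Qed.

End NearOutside.

Lemma leaves_near (U : istModel) (R : istReals U) (M X N : set R) (a : R)
    (y : R -> R) : cvx_subgroup M -> cvx_subgroup N ->
  leaves (R := R) M X a y N (y a) ->
  near_outside M a X (fun x => above N `|y x - y a|).
Proof.
move=> Mg Ng [W [[_ [r Mr HW]] _ out]]; exists r => // x _ Mx.
rewrite ltr_distl => /HW Wx; apply: above_norm => // Nx.
have xE : a + (x - a) = x by rewrite addrC subrK.
apply: (out (x - a)); rewrite ?xE//.
  by move=> /(cvx_subgroup_norm Mg)/(above_notin Mx).
by exists (y x - y a) => //=; rewrite addrC subrK.
Qed.

Lemma derivative_near (U : istModel) (R : istReals U) (M X : set R) (a : R)
    (y : R -> R) (dy : ext R) e :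
  derivative_is M X (fun x => ext_of_real (y x)) a dy -> above (npart dy) e ->
  near_outside M a X (fun x => `|(y x - y a) / (x - a) - rep dy| < e).
Proof.
move=> dyP De; have [_ /neutrix_cvx Dg _] := dyP.
have /Klim_outerP/(_ _ De) :
    Klim (outer M a) (X `\ a) (quotient (fun x => ext_of_real (y x)) a)
      (npart dy) dy.
  apply: lim_is_Klim dyP => x _.
  by apply: quotient_cvx_subgroup; apply: cvx_subgroup_set0.
apply: near_outside_mono => x _ /elt_abs_sub/(_ 0).
by rewrite addr0; apply; right; apply: cvx_subgroup0.
Qed.

(** The increments of y1 and y2 divided by x - a are perturbations D_i + v_i of
   their derivatives, and the increment of F is a sum of perturbed partial
   derivatives d_i + u_i times these increments; continuity of the two products
   concludes.  The two mixed limits are treated at once: all that is asked of the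
   base B is that the increments eventually enter its regions and are not both
   zero. *)
Lemma chain_rule_Klim (U : istModel) (R : istReals U) (B : set (set (R * R)))
    (X : set R) (y1 y2 : R -> R) (F : R * R -> ext R) (M : set R) (a : R)
    (N1 N2 : set R) (dy1 dy2 dF1 dF2 : ext R) :
  let Y := (fun x => (y1 x, y2 x)) @` X in
  let G := fun x => F (y1 x, y2 x) in
  let b := (y1 a, y2 a) in
  X a -> (forall y, Y y -> cvx_subgroup (npart (F y))) ->
  strongly_differentiable B N1 N2 Y F b ->
  (forall P, B P -> near_outside M a X (fun x =>
     P (y1 x - y1 a, y2 x - y2 a) /\ (y1 x - y1 a, y2 x - y2 a) <> (0, 0))) ->
  (forall e, above N1 e -> near_outside M a X (fun x => `|y1 x - y1 a| < e)) ->
  (forall e, above N2 e -> near_outside M a X (fun x => `|y2 x - y2 a| < e)) ->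
  derivative_is M X (fun x => ext_of_real (y1 x)) a dy1 ->
  derivative_is M X (fun x => ext_of_real (y2 x)) a dy2 ->
  partial1_is N1 Y F b dF1 ->
  partial2_is N2 Y F b dF2 ->
  zeroless dy1 \/ zeroless dF1 ->
  zeroless dy2 \/ zeroless dF2 ->
  let al := eadd (emul dF1 dy1) (emul dF2 dy2) in
  external_number (R := R) al /\
  Klim (outer M a) (X `\ a) (quotient G a) (npart al) al.
Proof.
move=> Y G b Xa Fg sF nearB near1 near2 dy1P dy2P pF1 pF2 z1 z2 al.
have [_ dy1n _] := dy1P; have [_ dy2n _] := dy2P.
have [_ dF1n _] := pF1; have [_ dF2n _] := pF2.
have aln : external_number (R := R) al.
  by apply: eadd_external; apply: emul_external.
split=> //; apply/Klim_outerP => e Ae.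
have Ae3 : above (npart al) (e / 3) := above_divn 2 (neutrix_cvx aln) Ae.
have [e1 [e1' [A1 A1' cont1]]] : exists e1 e2, [/\ above (npart dF1) e1,
    above (npart dy1) e2 & forall u v, `|u| < e1 -> `|v| < e2 ->
      `|(rep dF1 + u) * (rep dy1 + v) - rep dF1 * rep dy1| < e / 3].
  apply: emul_continuous => //; [exact: neutrix_cvx|exact: neutrix_cvx|].
  by move=> t At; apply: Ae3; left.
have [e2 [e2' [A2 A2' cont2]]] : exists e1 e2, [/\ above (npart dF2) e1,
    above (npart dy2) e2 & forall u v, `|u| < e1 -> `|v| < e2 ->
      `|(rep dF2 + u) * (rep dy2 + v) - rep dF2 * rep dy2| < e / 3].
  apply: emul_continuous => //; [exact: neutrix_cvx|exact: neutrix_cvx|].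
  by move=> t At; apply: Ae3; right.
have [W [_ [r1 [r2 [Nr1 Nr2 HW]]]] incr] := strong_increment pF1 pF2 sF.
have [P1 [P2 [/nearB nP1 /nearB nP2 {}incr]]] := incr _ _ A1 A2.
have := near_outside_and (near_outside_and nP1 nP2)
  (near_outside_and (near_outside_and (near1 _ Nr1) (near2 _ Nr2))
    (near_outside_and (derivative_near dy1P A1') (derivative_near dy2P A2'))).
apply: near_outside_mono => x [Xx xa].
move=> [[[P1x h0] [P2x _]] [[hr1 hr2] [v1 v2]]].
have k0 : x - a != 0 by rewrite subr_eq0; apply/eqP.
have E1 : y1 a + (y1 x - y1 a) = y1 x by rewrite addrC subrK.
have E2 : y2 a + (y2 x - y2 a) = y2 x by rewrite addrC subrK.
have := incr (y1 x - y1 a, y2 x - y2 a) h0; rewrite /= E1 E2.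
have Wx : W (y1 x, y2 x) by apply: HW; rewrite /= -ltr_distl.
move=> /(_ Wx P1x P2x) {}incr.
pose q := rep (quotient G a x).
have qt t : nmax (npart (G x)) (npart (G a)) t ->
    `|q + t / (x - a) - rep al| < e / 3 + e / 3.
  move=> /incr[u1 [u2 [ue1 ue2 E]]].
  have c1 := cont1 u1 _ ue1 v1; have c2 := cont2 u2 _ ue2 v2.
  have -> : q + t / (x - a) - rep al =
      ((rep dF1 + u1) * (rep dy1 + ((y1 x - y1 a) / (x - a) - rep dy1))
       - rep dF1 * rep dy1) +
      ((rep dF2 + u2) * (rep dy2 + ((y2 x - y2 a) / (x - a) - rep dy2))
       - rep dF2 * rep dy2).
    rewrite /q /= -mulrDl E mulrDl ![rep _ + (_ - rep _)]addrC !subrK /=.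
    by rewrite !mulrA; lra.
  by rewrite (le_lt_trans (ler_normD _ _))// ltrD.
have Ng : cvx_subgroup (nmax (npart (G x)) (npart (G a))).
  by apply: nmax_cvx_subgroup; apply: Fg; [exists x | exists a].
apply/elt_abs_sub => t [[t' Ht <-]|Kt]; last first.
  have := qt 0 (cvx_subgroup0 Ng); rewrite mul0r addr0.
  have := Ae3 _ Kt; rewrite /q; lra.
rewrite mulrC; have := qt t' Ht.
have := qt (- t') (cvx_subgroupN Ng Ht); rewrite mulNr.
have e0 := above_gt0 (neutrix_cvx aln) Ae.
rewrite -/q !ltr_norml => /andP[? ?] /andP[? ?].
rewrite -ltrBrDr ltr_norml; apply/andP; split; lra.
Qed.

Theorem theorem7p7 (U : istModel) (R : istReals U)
    (X : set R) (y1 y2 : R -> R) (F : R * R -> ext R)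
    (M : set R) (a : R) (N1 N2 : set R) (dy1 dy2 dF1 dF2 : ext R) :
  let Y := (fun x => (y1 x, y2 x)) @` X in
  let G := fun x => F (y1 x, y2 x) in
  let b := (y1 a, y2 a) in
  flexible1 X (fun x => ext_of_real (y1 x)) ->
  flexible1 X (fun x => ext_of_real (y2 x)) ->
  flexible2 Y F ->
  neutrix M ->
  interior1 M X a ->
  (* (a) *)
  neutrix N1 ->
  neutrix N2 ->
  interior2 N1 N2 Y b ->
  Klim (inner M 0) [set h | X (a + h)] (fun h => ext_of_real (y1 (a + h)))
    N1 (Ext (y1 a) N1) ->
  Klim (inner M 0) [set h | X (a + h)] (fun h => ext_of_real (y2 (a + h)))
    N2 (Ext (y2 a) N2) ->
  (* (b) *)
  leaves M X a y1 N1 (y1 a) /\ strongly_differentiable1 N1 N2 Y F b \/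
  leaves M X a y2 N2 (y2 a) /\ strongly_differentiable2 N1 N2 Y F b ->
  (* (c) *)
  derivative_is M X (fun x => ext_of_real (y1 x)) a dy1 ->
  derivative_is M X (fun x => ext_of_real (y2 x)) a dy2 ->
  partial1_is N1 Y F b dF1 ->
  partial2_is N2 Y F b dF2 ->
  zeroless dy1 \/ zeroless dF1 ->
  zeroless dy2 \/ zeroless dF2 ->
  derivative_well_defined M X G a /\
  derivative M X G a `<=` eset (eadd (emul dF1 dy1) (emul dF2 dy2)).
Proof.
move=> Y G b _ _ [_ Fn _] /neutrix_cvx Mg [V [_ [r Mr HV]] VX].
move=> /neutrix_cvx N1g /neutrix_cvx N2g _ lim1 lim2 hb dy1P dy2P pF1 pF2 z1 z2.
have Xa : X a.
  by apply/VX/HV; have := above_gt0 Mg Mr; lra.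
have Fg y : Y y -> cvx_subgroup (npart (F y)) by move=> /Fn/neutrix_cvx.
have near1 e : above N1 e -> near_outside M a X (fun x => `|y1 x - y1 a| < e).
  exact: Klim_inner_near.
have near2 e : above N2 e -> near_outside M a X (fun x => `|y2 x - y2 a| < e).
  exact: Klim_inner_near.
suff [aln alP] : let al := eadd (emul dF1 dy1) (emul dF2 dy2) in
    external_number (R := R) al /\
    Klim (outer M a) (X `\ a) (quotient G a) (npart al) al.
  split; first by exists (eadd (emul dF1 dy1) (emul dF2 dy2)).
  by move=> x; apply.
case: hb => -[out sF]; apply: (chain_rule_Klim Xa Fg sF) => //.
- move=> _ [d1 [d2 [Nd1 Nd2 ->]]].
  have := near_outside_and (leaves_near Mg N1g out)
    (near_outside_and (near1 _ Nd1) (near2 _ Nd2)).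
  apply: near_outside_mono => x _ [Nx [h1 h2]]; split=> // -[h10 _].
  by have := above_gt0 N1g Nx; rewrite h10 normr0 ltxx.
- move=> _ [d1 [d2 [Nd1 Nd2 ->]]].
  have := near_outside_and (leaves_near Mg N2g out)
    (near_outside_and (near1 _ Nd1) (near2 _ Nd2)).
  apply: near_outside_mono => x _ [Nx [h1 h2]]; split=> // -[_ h20].
  by have := above_gt0 N2g Nx; rewrite h20 normr0 ltxx.
Qed.
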